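(* Let $n\ge 3$ and let $C\subset\mathbb{S}^{n-1}$ be a spherical 3-distance 5-design which is not a tight spherical 5-design. Let $M=|C|$ and let $a<b<c$ be the three inner products of $C$. Then the inner products satisfy $|a|>|c|>|b|>0$; the number $c$ satisfies $$M=\frac{n\big((n+2)(n+3)c^2+4(n+2)c-n+1\big)(1-c)}{2c\,(3-(n+2)c^2)};$$ and $a$ and $b$ are the roots of the quadratic equation in $t$ $$(n+2)\big[(n+2)c^2+2c-1\big]t^2+2c(c+1)(n+2)t+3-(n+2)c^2=0.$$ In other words, $a=\alpha_0$, $b=\alpha_1$, $c=\alpha_2=s$, where $s$ is the maximal root of the equation $M=L_5(n,s)$ and $\alpha_0<\alpha_1<\alpha_2=s$ are the zeros of the third degree polynomial (in $t$) $$P_3(t)P_2(s)-P_3(s)P_2(t).$$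
   Context: $\mathbb{S}^{n-1}$ is the unit sphere in $\mathbb{R}^n$. A finite nonempty set $C\subset\mathbb{S}^{n-1}$ is called a spherical code. Its inner products are the numbers $\langle x,y\rangle$ with $x,y\in C$, $x\ne y$. $C$ is a 3-distance code if exactly three different distances (equivalently, exactly three different inner products) occur between distinct points of $C$. $P_i^{(n)}(t)$ denotes the Gegenbauer polynomial of degree $i$ associated with $\mathbb{S}^{n-1}$, normalized by $P_i^{(n)}(1)=1$. $C$ is a spherical $\tau$-design if for every $y\in\mathbb{S}^{n-1}$ and every real polynomial $f$ of degree at most $\tau$ one has $\sum_{x\in C}f(\langle x,y\rangle)=f_0|C|$, where $f_0$ is the coefficient of $P_0^{(n)}=1$ in the Gegenbauer expansion $f(t)=\sum_i f_iP_i^{(n)}(t)$. Every spherical 5-design on $\mathbb{S}^{n-1}$ has at least $n(n+1)$ points; it is called tight if it has exactly $n(n+1)$ points. $P_i(t)=P_i^{(\frac{n-1}{2},\frac{n-3}{2})}(t)$ is the Jacobi polynomial of degree $i$ with parameters $\left(\frac{n-1}{2},\frac{n-3}{2}\right)$, normalized by $P_i(1)=1$. $L_5(n,s)$ is the Levenshtein bound $$L_5(n,s)=\frac{n\big((n+2)(n+3)s^2+4(n+2)s-n+1\big)(1-s)}{2s\,(3-(n+2)s^2)}.$$ *)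

(* Defs.v *)
From mathcomp Require Import all_boot all_order all_algebra.
From mathcomp Require Import finmap reals ring.

Set Implicit Arguments.
Unset Strict Implicit.
Unset Printing Implicit Defensive.
Import Order.TTheory GRing.Theory Num.Theory.
Local Open Scope fset_scope.
Local Open Scope ring_scope.

Section Polynomials.
Variable R : realType.

(* Three-term recurrence
     (k + n - 2) P_(k+1) = (2k + n - 2) X P_k - k P_(k-1),
   which is the one of the ultraspherical polynomials of parameter
   (n - 2) / 2 rescaled so that P_k(1) = 1. *)
Fixpoint gegenbauer (n i : nat) {struct i} : {poly R} :=
  match i with
  | 0 => 1
  | 1 => 'X
  | (j.+1 as k).+1 =>
      ((2 * k%:R + n%:R - 2) / (k%:R + n%:R - 2)) *: ('X * gegenbauer n k)
      - (k%:R / (k%:R + n%:R - 2)) *: gegenbauer n j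
  end.

(* g lists the coefficients; trailing zeros are allowed. *)
Definition gegenbauer_expansion (n : nat) (f : {poly R}) (g : seq R) : Prop :=
  f = \sum_(i < size g) g`_i *: gegenbauer n i.

Definition rising (x : R) (k : nat) : R := \prod_(j < k) (x + j%:R).

(* 2F1(-i, i + al + be + 1; al + 1; (1 - X) / 2), i.e. the usual Jacobi
   polynomial divided by its value (al + 1)_i / i! at 1; the sign of (-i)_k
   has been absorbed into ((X - 1) / 2)^k. *)
Definition jacobi (al be : R) (i : nat) : {poly R} :=
  \sum_(k < i.+1)
     ('C(i, k)%:R * rising (i%:R + al + be + 1) k / rising (al + 1) k)
       *: (2^-1 *: ('X - 1)) ^+ k.

Lemma jacobi_at1 (al be : R) (i : nat) : (jacobi al be i).[1] = 1.
Proof.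
rewrite /jacobi horner_sum big_ord_recl /= big1 => [|k _].
  by rewrite expr0 hornerZ hornerC /rising !big_ord0 bin0 divr1 !mulr1 addr0.
by rewrite hornerZ horner_exp !hornerE subrr mulr0 expr0n /= mulr0.
Qed.

Lemma gegenbauerSS (n j : nat) :
  gegenbauer n j.+2 =
    ((2 * j.+1%:R + n%:R - 2) / (j.+1%:R + n%:R - 2)) *: ('X * gegenbauer n j.+1)
    - (j.+1%:R / (j.+1%:R + n%:R - 2)) *: gegenbauer n j.
Proof. by []. Qed.

Lemma gegenbauer_den_gt0 (n j : nat) : (2 <= n)%N ->
  0 < j.+1%:R + n%:R - 2 :> R.
Proof.
case: n => [|[|n]] // _; rewrite -natrD !addnS -addn2 natrD addrK.
by rewrite ltr0n addSn.
Qed.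

Lemma gegenbauer_at1 (n i : nat) : (2 <= n)%N -> (gegenbauer n i).[1] = 1.
Proof.
move=> n2; suff: (gegenbauer n i).[1] = 1 /\ (gegenbauer n i.+1).[1] = 1 by case.
elim: i => [|i [IH1 IH2]]; first by rewrite /= hornerC hornerX.
split=> //; rewrite gegenbauerSS.
have d0 : i.+1%:R + n%:R - 2 != 0 :> R by apply: lt0r_neq0; apply: gegenbauer_den_gt0.
rewrite hornerD hornerN !hornerZ hornerM hornerX IH1 IH2 !mulr1 -mulrBl.
rewrite (_ : 2 * _ + _ - _ - _ = i.+1%:R + n%:R - 2) ?divff //.
by ring.
Qed.

Lemma size_gegenbauer (n i : nat) : (2 <= n)%N -> size (gegenbauer n i) = i.+1.
Proof.
move=> n2.
suff: size (gegenbauer n i) = i.+1 /\ size (gegenbauer n i.+1) = i.+2 by case.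
elim: i => [|i [IH1 IH2]]; first by rewrite /= size_poly1 size_polyX.
split=> //; rewrite gegenbauerSS.
have d0 : 0 < i.+1%:R + n%:R - 2 :> R by apply: gegenbauer_den_gt0.
have e0 : (2 * i.+1%:R + n%:R - 2) / (i.+1%:R + n%:R - 2) != 0 :> R.
  rewrite mulf_neq0 ?invr_eq0 ?lt0r_neq0 //.
  by rewrite mulrDl mul1r -!addrA ltr_wpDl // addrA.
have sX : size ('X * gegenbauer n i.+1) = i.+3.
  by rewrite mulrC size_mulX ?IH2 // -size_poly_eq0 IH2.
rewrite size_polyDl size_scale ?sX //.
by rewrite size_polyN (leq_ltn_trans (size_scale_leq _ _)) // IH1.
Qed.

Lemma gegenbauer_expansion_exists (n : nat) (f : {poly R}) : (2 <= n)%N ->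
  exists g, gegenbauer_expansion n f g.
Proof.
move=> n2; suff H m : forall p : {poly R}, (size p <= m)%N ->
    exists g : nat -> R, p = \sum_(i < m) g i *: gegenbauer n i.
  have [g gE] := H _ f (leqnn _); exists (mkseq g (size f)).
  rewrite /gegenbauer_expansion size_mkseq {1}gE; apply: eq_bigr => i _.
  by rewrite nth_mkseq.
elim: m => [p|m IH p pm].
  by rewrite leqn0 size_poly_eq0 => /eqP ->; exists (fun=> 0); rewrite big_ord0.
pose P := gegenbauer n m; pose l := p`_m / P`_m.
have Pm0 : P`_m != 0.
  by rewrite -[m]/(m.+1.-1) -(size_gegenbauer m n2) -lead_coefE lead_coef_eq0
     -size_poly_eq0 size_gegenbauer.
have sq : (size (p - l *: P)%R <= m)%N.
  apply/leq_sizeP => j; rewrite leq_eqVlt => /predU1P[<-|mj].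
    by rewrite coefB coefZ mulfVK // subrr.
  rewrite coefB coefZ !nth_default ?mulr0 ?subrr ?size_gegenbauer //.
  exact: leq_trans pm mj.
have [g gE] := IH _ sq.
exists (fun i => if i == m then l else g i); rewrite big_ord_recr /= eqxx.
rewrite -[LHS](subrK (l *: P)) gE; congr (_ + _); apply: eq_bigr => i _.
by rewrite ltn_eqF.
Qed.

Lemma gegenbauer_free (n m : nat) (g : nat -> R) : (2 <= n)%N ->
  \sum_(i < m) g i *: gegenbauer n i = 0 -> forall i, (i < m)%N -> g i = 0.
Proof.
move=> n2; elim: m => // m IH; rewrite big_ord_recr /= => E.
have gm : g m = 0.
  apply/eqP; apply: contraTT isT => gm0; move/eqP: E; rewrite addrC addr_eq0.
  move/eqP/(congr1 (size : {poly R} -> nat)).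
  rewrite size_scale // size_gegenbauer // size_polyN => E.
  suff : (m.+1 <= m)%N by rewrite ltnn.
  rewrite E; apply: (leq_trans (size_sum _ _ _)); apply/bigmax_leqP => i _.
  by rewrite (leq_trans (size_scale_leq _ _)) // size_gegenbauer.
move: E; rewrite gm scale0r addr0 => /IH H i.
by rewrite ltnS leq_eqVlt => /predU1P[->|/H].
Qed.

Lemma gegenbauer_expansion_unique (n : nat) (f : {poly R}) (g h : seq R) :
  (2 <= n)%N -> gegenbauer_expansion n f g -> gegenbauer_expansion n f h ->
  forall i, g`_i = h`_i.
Proof.
rewrite /gegenbauer_expansion => n2 gE hE i.
pose m := maxn i.+1 (maxn (size g) (size h)).
have widen (s : seq R) : (size s <= m)%N ->
    \sum_(j < size s) s`_j *: gegenbauer n j = \sum_(j < m) s`_j *: gegenbauer n j.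
  move=> sm; rewrite (big_ord_widen m (fun j => s`_j *: gegenbauer n j)) //.
  rewrite big_mkcond; apply: eq_bigr => j _; case: ltnP => // js.
  by rewrite nth_default ?scale0r.
move: hE; rewrite gE !widen ?leq_max ?leqnn ?orbT // => E.
apply/eqP; rewrite -subr_eq0; apply/eqP.
apply: (@gegenbauer_free n m (fun j => g`_j - h`_j)) => //; last first.
  by rewrite leq_max ltnSn.
by under eq_bigr do rewrite scalerBl; rewrite sumrB E subrr.
Qed.

End Polynomials.

Section SphericalCodes.
Variables (R : realType) (n : nat).
Implicit Types (x y : 'rV[R]_n) (C : {fset 'rV[R]_n}).

Definition dot x y : R := \sum_(i < n) x 0 i * y 0 i.

Definition on_sphere x : Prop := dot x x = 1.

Definition spherical_code C : Prop :=
  C != fset0 /\ forall x, x \in C -> on_sphere x.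

Definition inner_products C : {fset R} :=
  [fset dot x y | x in C, y in C & x != y].

Lemma inner_productsP C (t : R) :
  reflect (exists x y, [/\ x \in C, y \in C, x != y & t = dot x y])
          (t \in inner_products C).
Proof.
apply: (iffP idP) => [/imfset2P[x xC [y]]|[x [y [xC yC xy ->]]]].
  by rewrite inE => /andP[yC xy] ->; exists x, y.
by apply/imfset2P; exists x => //; exists y => //; rewrite inE yC.
Qed.

Definition three_distance C : Prop := #|` inner_products C| = 3%N.

Definition spherical_design (tau : nat) C : Prop :=
  forall y, on_sphere y ->
  forall (f : {poly R}) (g : seq R),
    (size f <= tau.+1)%N -> gegenbauer_expansion n f g ->
    \sum_(x <- C) f.[dot x y] = g`_0 * #|` C|%:R.

Definition tight_5_design C : Prop :=
  spherical_design 5 C /\ #|` C| = (n * (n + 1))%N.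

(* When the denominator vanishes the value is 0, so that
   M = levenshtein5 s with M > 0 forces a nonzero denominator. *)
Definition levenshtein5 (s : R) : R :=
  n%:R * ((n%:R + 2) * (n%:R + 3) * s ^+ 2 + 4 * (n%:R + 2) * s - n%:R + 1)
    * (1 - s)
  / (2 * s * (3 - (n%:R + 2) * s ^+ 2)).

Definition max_levenshtein5_root (M : nat) (s : R) : Prop :=
  M%:R = levenshtein5 s /\ forall t, M%:R = levenshtein5 t -> t <= s.

Definition adjacent_jacobi (i : nat) : {poly R} :=
  jacobi ((n%:R - 1) / 2) ((n%:R - 3) / 2) i.

Definition node_poly (s : R) : {poly R} :=
  (adjacent_jacobi 2).[s] *: adjacent_jacobi 3
  - (adjacent_jacobi 3).[s] *: adjacent_jacobi 2.

End SphericalCodes.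

Arguments levenshtein5 {R} n s.
Arguments max_levenshtein5_root {R} n M s.
Arguments adjacent_jacobi {R} n i.
Arguments node_poly {R} n s.

(* Main.v *)
Require Import Defs.
From mathcomp Require Import all_boot all_order all_algebra.
From mathcomp Require Import finmap reals ring lra.
Import Order.TTheory GRing.Theory Num.Theory.
Local Open Scope fset_scope.
Local Open Scope ring_scope.

(** Fix a point y of C.  A spherical 5-design averages every polynomial in
    <x, y> of degree at most 5 exactly, and <x, y> takes only the values
    a, b, c and, at x = y, 1.  So the moments of a spherical projection up to
    order 5 are integrated by a quadrature with the four nodes a, b, c, 1, the
    weight of 1 being 1 / M.  Put q(t) = (t - a) (t - b) (t - c) and u = abc.
    Averaging (1 - t) q, t (1 - t) q and q (distance_cubic) gives
<<
      q = N + u D,   N = t^3 - 3 t / (n + 2),   D = (n + 2) t^2 + 2 t - 1,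
      2 u M = n q(1).
>>
    Thus everything depends on the single parameter u, and M determines u.

    As a, b, c lie in [-1, 1), the sign of q(1) gives u > 0 and that of q(-1)
    gives (n + 2) u <= 1, with equality only if M = n (n + 1), that is, only for
    tight designs.  The strict inequality and q(c) = 0 give (n + 2) c^2 > 1
    (c_large).  The roots have product u > 0 and sum -(n + 2) u < 0, so
    a < b < 0 < c; moreover N is odd, so q(-c) = 2 u ((n + 2) c^2 - 1) > 0, which
    puts -c between a and b: this is |a| > |c| > |b|.

    The other assertions eliminate u.  The relation q(c) = 0 reads
    u D(c) = - N(c).  Inserted in q(t) / (t - c) it gives the quadratic equation
    of a and b; inserted in 2 u M = n q(1) it gives M = L_5(n, c).  Conversely a
    root t of M = L_5(n, t) satisfies u D(t) = - N(t), because M determines u, so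
    it is one of a, b, c (leven_roots) and the largest root is c.  Finally the
    adjacent Jacobi polynomials are P_2 = D / (n + 3) and a combination P_3 of N
    and D, so that the node polynomial at c is a multiple of
    D(c) N - N(c) D = D(c) q (node_polyE). *)

(** * Moments of designs *)

Section Moments.
Set Implicit Arguments.
Unset Strict Implicit.
Variables (R : realType) (n : nat).
Hypothesis n3 : (3 <= n)%N.

Lemma n_ge3 : 3 <= n%:R :> R. Proof. by rewrite ler_nat. Qed.

(** The three-term recurrence solved for its middle term.  For k = 0 the last
    coefficient vanishes, so the truncated predecessor does not matter. *)
Lemma mulX_gegenbauer (k : nat) :
  'X * gegenbauer R n k =
    ((k%:R + n%:R - 2) / (2 * k%:R + n%:R - 2)) *: gegenbauer R n k.+1
    + (k%:R / (2 * k%:R + n%:R - 2)) *: gegenbauer R n k.-1.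
Proof.
have n3R := n_ge3; case: k => [|j].
  rewrite /= mulr1 mul0r scale0r addr0 mulr0 divff ?scale1r //.
  by apply: lt0r_neq0; lra.
have j0 : 0 <= j%:R :> R by apply: ler0n.
rewrite gegenbauerSS scalerBr !scalerA succnK -(natr1 j).
set a := (X in X *: ('X * _)); set b := (X in _ - X *: _ + _).
have -> : a = 1 by rewrite /a; field; rewrite !lt0r_neq0 //=; lra.
have -> : b = (j%:R + 1) / (2 * (j%:R + 1) + n%:R - 2).
  by rewrite /b; field; rewrite !lt0r_neq0 //=; lra.
by rewrite scale1r subrK.
Qed.

(** Gegenbauer coefficients of 'X * f from those of f.  Multiplication by 'X only
    links neighbouring indices, and the zeroth output, g`_1 / n, is what produces
    the moments below. *)
Definition mulX_coef (g : seq R) : seq R :=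
  mkseq (fun i =>
    (if i is j.+1 then g`_j * ((j%:R + n%:R - 2) / (2 * j%:R + n%:R - 2)) else 0)
    + g`_i.+1 * (i.+1%:R / (2 * i.+1%:R + n%:R - 2))) (size g).+1.

Lemma gegenbauer_expansion_mulX (f : {poly R}) (g : seq R) :
  gegenbauer_expansion n f g -> gegenbauer_expansion n ('X * f) (mulX_coef g).
Proof.
rewrite /gegenbauer_expansion size_mkseq => ->.
rewrite mulr_sumr; under eq_bigr do
  rewrite -scalerAr mulX_gegenbauer scalerDr !scalerA.
rewrite big_split /=; under [RHS]eq_bigr do rewrite nth_mkseq // scalerDl.
rewrite [RHS]big_split /=; congr (_ + _).
  by rewrite big_ord_recl /= scale0r add0r.
(* The downward shift loses the term of index 0, whose coefficient is 0, and
   gains two terms beyond the end of g. *)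
pose F i := (g`_i * (i%:R / (2 * i%:R + n%:R - 2))) *: gegenbauer R n i.-1.
transitivity (\sum_(i < (size g).+2) F i).
  rewrite !big_ord_recr /= /F [_`_(size g)]nth_default //.
  by rewrite [_`_(size g).+1]nth_default // !mul0r !scale0r !addr0.
by rewrite big_ord_recl /F /= mul0r mulr0 scale0r add0r.
Qed.

Definition monomial_coef (k : nat) : seq R := iter k mulX_coef [:: 1].

Lemma gegenbauer_expansion_Xn (k : nat) :
  gegenbauer_expansion n 'X^k (monomial_coef k).
Proof.
elim: k => [|k IH]; last by rewrite exprS; apply: gegenbauer_expansion_mulX.
by rewrite /gegenbauer_expansion big_ord1 /= expr0 scale1r.
Qed.

(** The constant Gegenbauer coefficients of 1, X, ..., X^5 are the moments of
    the projection to a line of the uniform measure on the sphere. *)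
Lemma monomial_coef0 :
  [seq (monomial_coef k)`_0 | k <- iota 0 6] =
  [:: 1; 0; 1 / n%:R; 0; 3 / (n%:R * (n%:R + 2)); 0].
Proof.
have n3R := n_ge3.
rewrite /monomial_coef /=.
do ![congr (_ :: _)]; field; rewrite ?lt0r_neq0 //=; try lra.
Qed.

(** Linearity turns the design property into an explicit functional of the
    monomial coefficients: no Gegenbauer polynomial appears from here on. *)
Lemma design_sum (C : {fset 'rV[R]_n}) (y : 'rV[R]_n) (p : {poly R}) :
  spherical_design 5 C -> on_sphere y -> (size p <= 6)%N ->
  \sum_(x <- C) p.[dot x y] =
    (p`_0 + p`_2 / n%:R + p`_4 * (3 / (n%:R * (n%:R + 2)))) * #|` C|%:R.
Proof.
move=> C5 y1 p6.
under eq_bigr do rewrite (horner_coef_wide _ p6).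
have mom k : (k < 6)%N ->
    \sum_(x <- C) dot x y ^+ k = (monomial_coef k)`_0 * #|` C|%:R.
  move=> k6; rewrite -(C5 y y1 'X^k (monomial_coef k)) ?size_polyXn //.
    by apply: eq_bigr => x _; rewrite hornerXn.
  exact: gegenbauer_expansion_Xn.
rewrite exchange_big /=.
under eq_bigr do rewrite -mulr_sumr mom // mulrA.
rewrite -mulr_suml; congr (_ * _).
rewrite !big_ord_recl big_ord0 /=; have := monomial_coef0.
move=> -[-> -> -> -> ->].
by rewrite /bump /=; ring.
Qed.

End Moments.

(** * Inner products of unit vectors *)

Section Dot.
Set Implicit Arguments.
Unset Strict Implicit.
Variables (R : realType) (n : nat).
Implicit Types (x y : 'rV[R]_n).

Lemma dot_ltr1 x y : on_sphere x -> on_sphere y -> x != y -> dot x y < 1.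
Proof.
rewrite /on_sphere => x1 y1 xy.
have sq : \sum_(i < n) (x 0 i - y 0 i) ^+ 2 = 2 - 2 * dot x y.
  have -> : 2 - 2 * dot x y = dot x x + dot y y - 2 * dot x y.
    by rewrite x1 y1; ring.
  rewrite /dot mulr_sumr -big_split -sumrB.
  by apply: eq_bigr => i _ /=; ring.
have sq_ge0 : 0 <= \sum_(i < n) (x 0 i - y 0 i) ^+ 2.
  by apply: sumr_ge0 => i _; apply: sqr_ge0.
rewrite ltNge; apply: contra xy => xy1; apply/eqP/rowP => i.
have sq0 : \sum_(i < n) (x 0 i - y 0 i) ^+ 2 = 0.
  by apply/le_anti; rewrite sq_ge0 andbT sq; lra.
apply/eqP; rewrite -subr_eq0 -sqrf_eq0; apply/eqP.
by apply: (psumr_eq0P _ sq0) => // j _; apply: sqr_ge0.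
Qed.

Lemma dot_geN1 x y : on_sphere x -> on_sphere y -> -1 <= dot x y.
Proof.
rewrite /on_sphere => x1 y1.
have sq : \sum_(i < n) (x 0 i + y 0 i) ^+ 2 = 2 + 2 * dot x y.
  have -> : 2 + 2 * dot x y = dot x x + dot y y + 2 * dot x y.
    by rewrite x1 y1; ring.
  rewrite /dot mulr_sumr -!big_split.
  by apply: eq_bigr => i _ /=; ring.
suff : 0 <= \sum_(i < n) (x 0 i + y 0 i) ^+ 2 by rewrite sq; lra.
by apply: sumr_ge0 => i _; apply: sqr_ge0.
Qed.

End Dot.

(** * Cubics of the pencil and the Levenshtein bound *)

Section Pencil.
Set Implicit Arguments.
Unset Strict Implicit.
Variable R : realType.

(** Up to a factor, the Gegenbauer polynomial of degree 3. *)
Definition oddCubic (d t : R) : R := t ^+ 3 - 3 / (d + 2) * t.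

(** Up to a factor, the Jacobi polynomial of degree 2 for the weight
    (1 - t) (1 - t^2)^((d - 3) / 2). *)
Definition adjQuadratic (d t : R) : R := (d + 2) * t ^+ 2 + 2 * t - 1.

(** What the design property leaves of a 3-distance 5-design of M points: a, b, c
    are the zeros of a member of the pencil spanned by oddCubic and
    adjQuadratic, and its value at 1 is tied to M, because 1 / M is the weight
    of the node 1 in the quadrature with nodes a, b, c, 1. *)
Record pencil_nodes (d M u a b c : R) : Prop := {
  dim_ge3 : 3 <= d;
  size_gt0 : 0 < M;
  a_lt_b : a < b;
  b_lt_c : b < c;
  a_geN1 : -1 <= a;
  c_lt1 : c < 1;
  nodesE : forall t,
    (t - a) * (t - b) * (t - c) = oddCubic d t + u * adjQuadratic d t;
  weightE : 2 * u * M = d * (oddCubic d 1 + u * adjQuadratic d 1)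
}.

Lemma dim2_neq0 (d : R) : 3 <= d -> d + 2 != 0.
Proof. by move=> d3; apply: lt0r_neq0; lra. Qed.

(** By weightE, u has the sign of q(1) = (1 - a) (1 - b) (1 - c). *)
Lemma product_gt0 (d M u a b c : R) : pencil_nodes d M u a b c -> 0 < u.
Proof.
move=> [d3 M0 hab hbc ha hc qE ME].
have : 0 < 2 * u * M by rewrite ME -qE !mulr_gt0 // ?subr_gt0; lra.
by rewrite pmulr_lgt0 // pmulr_rgt0.
Qed.

(** Evaluation at 0, 1 and -1 isolates the coefficient of t^2. *)
Lemma sum_eq (d M u a b c : R) :
  pencil_nodes d M u a b c -> a + b + c = - ((d + 2) * u).
Proof.
move=> [_ _ _ _ _ _ qE _]; have := qE 1; have := qE (-1); have := qE 0.
rewrite /oddCubic /adjQuadratic; set v := 3 / (d + 2) => e0 e1 e2; lra.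
Qed.

Lemma product_eq (d M u a b c : R) : pencil_nodes d M u a b c -> a * b * c = u.
Proof.
move=> [_ _ _ _ _ _ qE _]; have := qE 0.
rewrite /oddCubic /adjQuadratic; set v := 3 / (d + 2) => e0; lra.
Qed.

(** All nodes are at least -1, so q(-1) <= 0. *)
Lemma product_le (d M u a b c : R) :
  pencil_nodes d M u a b c -> (d + 2) * u <= 1.
Proof.
move=> [d3 M0 hab hbc ha hc qE ME].
have e : (1 + a) * (1 + b) * (1 + c) = (d - 1) / (d + 2) * (1 - (d + 2) * u).
  transitivity (- ((-1 - a) * (-1 - b) * (-1 - c))); first by ring.
  by rewrite qE /oddCubic /adjQuadratic; field; apply: dim2_neq0.
have : 0 <= (1 + a) * (1 + b) * (1 + c) by rewrite !mulr_ge0 //; lra.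
by rewrite e pmulr_rge0 ?subr_ge0 // divr_gt0 //; lra.
Qed.

Lemma card_eq (d M u a b c : R) : pencil_nodes d M u a b c ->
  (d + 2) * (2 * u * M) = d * ((d - 1) + (d + 3) * ((d + 2) * u)).
Proof.
move=> [d3 _ _ _ _ _ _ ->].
by rewrite /oddCubic /adjQuadratic; field; apply: dim2_neq0.
Qed.

(** Equality in product_le would force M = d (d + 1). *)
Lemma product_lt (d M u a b c : R) : pencil_nodes d M u a b c ->
  M <> d * (d + 1) -> (d + 2) * u < 1.
Proof.
move=> H nt; rewrite lt_neqAle (product_le H) andbT; apply/eqP => u1.
apply: nt; have := card_eq H.
rewrite (_ : _ * (2 * u * M) = 2 * M * ((d + 2) * u)); last by ring.
by rewrite u1; lra.
Qed.

(** The product of the nodes is positive and their sum is negative. *)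
Lemma distance_signs (d M u a b c : R) :
  pencil_nodes d M u a b c -> [/\ a < 0, b < 0 & 0 < c].
Proof.
move=> H; have u0 := product_gt0 H; have s := sum_eq H; have p := product_eq H.
have [d3 _ hab hbc _ _ _ _] := H.
have du0 : 0 < (d + 2) * u by rewrite mulr_gt0 //; lra.
have a0 : a < 0 by lra.
have bc0 : b * c < 0 by rewrite -(nmulr_rgt0 _ a0) mulrA p.
have c0 : 0 < c.
  rewrite ltNge; apply/negP => c0.
  by have : 0 <= b * c; [rewrite mulr_le0 //; lra | lra].
by split=> //; rewrite -(pmulr_llt0 _ c0).
Qed.

Lemma oddCubic_c (d M u a b c : R) : pencil_nodes d M u a b c ->
  oddCubic d c = - (u * adjQuadratic d c).
Proof. by move=> H; apply/eqP; rewrite -addr_eq0 -(nodesE H) subrr mulr0. Qed.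

Lemma node_relation (d M u a b c : R) : pencil_nodes d M u a b c ->
  (d + 2) * u * adjQuadratic d c = c * (3 - (d + 2) * c ^+ 2).
Proof.
move=> H; have d2 := dim2_neq0 (dim_ge3 H).
have -> : (d + 2) * u * adjQuadratic d c = - ((d + 2) * oddCubic d c).
  by rewrite (oddCubic_c H); ring.
by rewrite /oddCubic; field.
Qed.

(** Otherwise node_relation would give 2 c <= 2 (d + 2) u c, against
    (d + 2) u < 1. *)
Lemma c_large (d M u a b c : R) : pencil_nodes d M u a b c ->
  M <> d * (d + 1) -> 1 < (d + 2) * c ^+ 2.
Proof.
move=> H nt; have [_ _ c0] := distance_signs H.
have u0 := product_gt0 H; have u1 := product_lt H nt.
have e := node_relation H; have d3 := dim_ge3 H.
rewrite ltNge; apply/negP => x1.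
have du0 : 0 < (d + 2) * u by rewrite mulr_gt0 //; lra.
have h1 : 0 <= (d + 2) * u * (1 - (d + 2) * c ^+ 2).
  by rewrite mulr_ge0 ?subr_ge0 // ltW.
have h2 : 0 < c * (1 - (d + 2) * u) by rewrite mulr_gt0 // subr_gt0.
have h3 : 0 <= c * (1 - (d + 2) * c ^+ 2).
  by rewrite mulr_ge0 ?subr_ge0 // ltW.
rewrite /adjQuadratic in e; lra.
Qed.

Lemma adjQuadratic_c_gt0 (d M u a b c : R) : pencil_nodes d M u a b c ->
  M <> d * (d + 1) -> 0 < adjQuadratic d c.
Proof.
move=> H nt; have [_ _ c0] := distance_signs H; have := c_large H nt.
by rewrite /adjQuadratic; lra.
Qed.

(** Since oddCubic is odd, q(-c) = q(-c) + q(c) = 2 u ((d + 2) c^2 - 1), which is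
    positive by c_large: hence -c, which is below c, lies between a and b. *)
Lemma distances_abs (d M u a b c : R) : pencil_nodes d M u a b c ->
  M <> d * (d + 1) -> [/\ `|c| < `|a|, `|b| < `|c| & 0 < `|b|].
Proof.
move=> H nt; have [a0 b0 c0] := distance_signs H.
have u0 := product_gt0 H.
have q : (- c - a) * (- c - b) * (- c - c) = 2 * u * ((d + 2) * c ^+ 2 - 1).
  rewrite (nodesE H) (_ : oddCubic d (- c) = - oddCubic d c).
    by rewrite (oddCubic_c H) /adjQuadratic; ring.
  by rewrite /oddCubic; ring.
have : 0 < (- c - a) * (- c - b) * (- c - c).
  by rewrite q mulr_gt0 ?subr_gt0 ?(c_large H) // mulr_gt0.
rewrite nmulr_lgt0; last lra.
have := a_lt_b H; rewrite (ltr0_norm a0) (ltr0_norm b0) (gtr0_norm c0) => hab ab.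
have ca : 0 < - c - a.
  rewrite ltNge; apply/negP => ca.
  by have : 0 <= (- c - a) * (- c - b); [rewrite mulr_le0 //; lra | lra].
by move: ab; rewrite pmulr_rlt0 // => ab; split; lra.
Qed.

Definition leven_num (d t : R) : R :=
  d * ((d + 2) * (d + 3) * t ^+ 2 + 4 * (d + 2) * t - d + 1) * (1 - t).
Definition leven_den (d t : R) : R := 2 * t * (3 - (d + 2) * t ^+ 2).

(** The equation M = L_5(t), cleared of denominators, is a cubic equation with
    the same zeros as q: M determines the member of the pencil.  Hence a, b and
    c are the only candidates for a root. *)
Lemma leven_node (d M u a b c t : R) : pencil_nodes d M u a b c ->
  u * (M * leven_den d t - leven_num d t) =
  - (d * (d - 1)) * ((t - a) * (t - b) * (t - c)).
Proof.
move=> H; have d2 := dim2_neq0 (dim_ge3 H); rewrite (nodesE H).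
apply: (mulfI d2).
transitivity ((d + 2) * (2 * u * M) * (t * (3 - (d + 2) * t ^+ 2))
  - (d + 2) * u * leven_num d t); first by rewrite /leven_den; ring.
rewrite (card_eq H) /leven_num /oddCubic /adjQuadratic; field; exact: d2.
Qed.

(** The quotient is 0 when its denominator vanishes, and M is not. *)
Lemma levenE (d M t : R) : 0 < M -> M = leven_num d t / leven_den d t ->
  M * leven_den d t = leven_num d t.
Proof.
move=> M0 e; have den0 : leven_den d t != 0.
  by apply: contraTneq M0 => den0; rewrite e den0 invr0 mulr0 ltxx.
by rewrite {1}e divfK.
Qed.

Lemma leven_roots (d M u a b c t : R) : pencil_nodes d M u a b c ->
  M = leven_num d t / leven_den d t -> [\/ t = a, t = b | t = c].
Proof.
move=> H /(levenE (size_gt0 H)) e; have d3 := dim_ge3 H.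
have k0 : - (d * (d - 1)) != 0.
  by rewrite oppr_eq0 mulf_neq0 // lt0r_neq0 //; lra.
have /eqP := leven_node t H; rewrite e subrr mulr0 eq_sym.
rewrite mulf_eq0 (negbTE k0) !mulf_eq0 !subr_eq0 /= => /orP[/orP[]|] /eqP.
- exact: Or31.
- exact: Or32.
- exact: Or33.
Qed.

(** node_relation makes the denominator at c positive. *)
Lemma leven_c (d M u a b c : R) : pencil_nodes d M u a b c ->
  M <> d * (d + 1) -> M = leven_num d c / leven_den d c.
Proof.
move=> H nt; have [_ _ c0] := distance_signs H; have u0 := product_gt0 H.
have d3 := dim_ge3 H.
have den0 : leven_den d c != 0.
  rewrite lt0r_neq0 // /leven_den -mulrA -(node_relation H).
  by rewrite !mulr_gt0 ?(adjQuadratic_c_gt0 H) //; lra.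
have := leven_node c H; rewrite subrr !mulr0 => /eqP.
rewrite mulf_eq0 (gt_eqF u0) subr_eq0 => /eqP <-.
by rewrite mulfK.
Qed.

(** Sum and product of a and b follow from those of a, b, c, and u is eliminated
    by node_relation. *)
Lemma quadratic_nodes (d M u a b c t : R) : pencil_nodes d M u a b c ->
  (d + 2) * ((d + 2) * c ^+ 2 + 2 * c - 1) * t ^+ 2
    + 2 * c * (c + 1) * (d + 2) * t + 3 - (d + 2) * c ^+ 2
  = (d + 2) * adjQuadratic d c * ((t - a) * (t - b)).
Proof.
move=> H; have [_ _ c0] := distance_signs H; have cn0 := lt0r_neq0 c0.
have e := node_relation H; have s := sum_eq H; have p := product_eq H.
have s' : (d + 2) * adjQuadratic d c * (a + b) = - (2 * c * (c + 1) * (d + 2)).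
  rewrite (_ : a + b = - ((d + 2) * u) - c); last by rewrite -s; ring.
  transitivity (- (d + 2) * ((d + 2) * u * adjQuadratic d c)
    - (d + 2) * c * adjQuadratic d c); first by ring.
  by rewrite e /adjQuadratic; ring.
have p' : (d + 2) * adjQuadratic d c * (a * b) = 3 - (d + 2) * c ^+ 2.
  by apply: (mulIf cn0); rewrite [RHS]mulrC -e -p; ring.
transitivity ((d + 2) * adjQuadratic d c * t ^+ 2
  - (d + 2) * adjQuadratic d c * (a + b) * t
  + (d + 2) * adjQuadratic d c * (a * b)); last by ring.
by rewrite s' p' /adjQuadratic; ring.
Qed.

End Pencil.

(** * From designs to the pencil *)

Section ThreeDistances.
Set Implicit Arguments.
Unset Strict Implicit.
Variables (R : realType) (n : nat) (C : {fset 'rV[R]_n}) (a b c : R).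
Hypotheses (n3 : (3 <= n)%N) (hC : spherical_code C)
  (C5 : spherical_design 5 C) (habc : inner_products C = [fset a; b; c]).

Local Notation d := (n%:R : R).
Local Notation M := (#|` C|%:R : R).

(** A polynomial that kills the three inner products sees a point y of C only
    through the diagonal term x = y. *)
Lemma design_annihilator (p : {poly R}) :
  (size p <= 6)%N -> root p a -> root p b -> root p c ->
  p.[1] = (p`_0 + p`_2 / d + p`_4 * (3 / (d * (d + 2)))) * M.
Proof.
move=> p6 /rootP pa /rootP pb /rootP pc.
have [/fset0Pn[y yC] C1] := hC; have y1 := C1 y yC.
rewrite -(design_sum n3 C5 y1 p6) (bigD1_seq y) ?fset_uniq //= y1.
rewrite big1_seq ?addr0 // => x /andP[xy xC].
have : dot x y \in inner_products C by apply/inner_productsP; exists x, y.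
by rewrite habc !inE => /orP[/orP[]|] /eqP ->.
Qed.

Lemma card_gt0 : 0 < M.
Proof. by rewrite ltr0n cardfs_gt0; case: hC. Qed.

(** With q(t) = (t - a) (t - b) (t - c), the polynomials (1 - t) q and
    t (1 - t) q also vanish at 1, so their mean over the sphere is 0; these two
    linear equations express the first two elementary symmetric functions of
    a, b, c by the third.  The mean of q itself gives the size of C. *)
Lemma distance_cubic (u := a * b * c) :
  (forall t, (t - a) * (t - b) * (t - c) = oddCubic d t + u * adjQuadratic d t)
  /\ 2 * u * M = d * (oddCubic d 1 + u * adjQuadratic d 1).
Proof.
have d3 : 3 <= d := n_ge3 R n3; have M0 := card_gt0.
have d0 : d != 0 by apply: lt0r_neq0; lra.
have d2 : d + 2 != 0 by apply: lt0r_neq0; lra.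
pose s1 := a + b + c; pose s2 := a * b + a * c + b * c.
(* The coefficients, from degree 0, of (1 - t) q, t (1 - t) q and q. *)
have E (s : seq R) (s6 : (size s <= 6)%N) :=
  design_annihilator (leq_trans (size_Poly s) s6).
have E1 := E [:: - u; s2 + u; - s1 - s2; 1 + s1; -1] isT.
have E2 := E [:: 0; - u; s2 + u; - s1 - s2; 1 + s1; -1] isT.
have E3 := E [:: - u; s2; - s1; 1] isT.
rewrite !rootE !horner_Poly !coef_Poly /= in E1 E2 E3.
have e1 : (s1 + s2 + d * u) * (d + 2) = -3.
  have /eqP : (- u + (- s1 - s2) / d + -1 * (3 / (d * (d + 2)))) * M = 0.
    by rewrite -E1; first ring; apply/eqP; rewrite /s1 /s2 /u; ring.
  rewrite mulf_eq0 (gt_eqF M0) orbF => /eqP e.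
  have : d * (d + 2) * (- u + (- s1 - s2) / d + -1 * (3 / (d * (d + 2)))) = 0.
    by rewrite e mulr0.
  rewrite (_ : d * _ * _ = - (s1 + s2 + d * u) * (d + 2) - 3); first lra.
  by field; rewrite d0 d2.
have e2 : (d + 2) * (s2 + u) = -3 * (1 + s1).
  have /eqP : (0 + (s2 + u) / d + (1 + s1) * (3 / (d * (d + 2)))) * M = 0.
    by rewrite -E2; first ring; apply/eqP; rewrite /s1 /s2 /u; ring.
  rewrite mulf_eq0 (gt_eqF M0) orbF => /eqP e.
  have : d * (d + 2) * (0 + (s2 + u) / d + (1 + s1) * (3 / (d * (d + 2)))) = 0.
    by rewrite e mulr0.
  rewrite (_ : d * _ * _ = (d + 2) * (s2 + u) + 3 * (1 + s1)); first lra.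
  by field; rewrite d0 d2.
(* Subtracting e2 from e1 eliminates s2. *)
have s1E : s1 = - (d + 2) * u.
  apply: (@mulfI _ (d - 1)); first by apply: lt0r_neq0; lra.
  by move: e1 e2; clear; move: s1 s2 => s1 s2 e1 e2; lra.
have s2E : s2 = 2 * u - 3 / (d + 2).
  apply: (@mulfI _ (d + 2)) => //.
  rewrite (_ : (d + 2) * s2 = -3 * (1 + s1) - (d + 2) * u); last by rewrite -e2; ring.
  by rewrite s1E; field.
have qE t : (t - a) * (t - b) * (t - c) = oddCubic d t + u * adjQuadratic d t.
  transitivity (t ^+ 3 - s1 * t ^+ 2 + s2 * t - u); first by rewrite /s1 /s2 /u; ring.
  by rewrite s1E s2E /oddCubic /adjQuadratic; ring.
split=> //; rewrite -qE.
rewrite (_ : (1 - a) * _ * _ = (- u + - s1 / d + 0 * (3 / (d * (d + 2)))) * M).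
  by rewrite s1E; field; rewrite d0 d2.
by rewrite -E3; [|apply/eqP..]; rewrite /s1 /s2 /u; ring.
Qed.

Lemma design_pencil : a < b -> b < c ->
  pencil_nodes d M (a * b * c) a b c.
Proof.
move=> hab hbc; have [qE ME] := distance_cubic; have [_ C1] := hC.
have /inner_productsP[x [y [/C1 x1 /C1 y1 _ aE]]] : a \in inner_products C.
  by rewrite habc !inE eqxx.
have /inner_productsP[x' [y' [/C1 x1' /C1 y1' xy' cE]]] : c \in inner_products C.
  by rewrite habc !inE eqxx orbT.
split=> //; [exact: n_ge3 | exact: card_gt0 | by rewrite aE; apply: dot_geN1|].
by rewrite cE; apply: dot_ltr1.
Qed.

End ThreeDistances.

(** * The node polynomial *)

Lemma poly_ext (R : numDomainType) (p q : {poly R}) :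
  (forall t, p.[t] = q.[t]) -> p = q.
Proof.
move=> pq; apply/eqP; rewrite -subr_eq0; apply: contraT => pq0.
have := @max_poly_roots _ _ [seq i%:R | i <- iota 0 (size (p - q))] pq0.
rewrite size_map size_iota ltnn => -> //.
- by apply/allP => t _; rewrite rootE hornerD hornerN pq subrr.
- by rewrite map_inj_uniq ?iota_uniq // => i j /eqP; rewrite eqr_nat => /eqP.
Qed.

Section Jacobi.
Set Implicit Arguments.
Unset Strict Implicit.
Variables (R : realType) (n : nat).
Hypothesis n3 : (3 <= n)%N.
Local Notation d := (n%:R : R).

Lemma horner_jacobi (al be t : R) i : (jacobi al be i).[t] =
  \sum_(k < i.+1) ('C(i, k)%:R * rising (i%:R + al + be + 1) k
    / rising (al + 1) k) * ((t - 1) / 2) ^+ k.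
Proof.
rewrite /jacobi horner_sum; apply: eq_bigr => k _.
by rewrite hornerZ horner_exp !hornerE [2^-1 * _]mulrC.
Qed.

Lemma adjacent_jacobi2 t :
  (adjacent_jacobi n 2).[t] = adjQuadratic d t / (d + 3).
Proof.
have d3 : 3 <= d := n_ge3 R n3.
rewrite horner_jacobi !big_ord_recl big_ord0 /rising !big_ord_recl !big_ord0.
rewrite /= /bump /= !(add1n, addn0) bin0 bin1 binn /adjQuadratic.
by field; rewrite !lt0r_neq0 //=; lra.
Qed.

(** The two coefficients are found by comparing leading terms and values at 1. *)
Lemma adjacent_jacobi3 : exists lam mu,
  0 < lam /\
  forall t, (adjacent_jacobi n 3).[t] = lam * oddCubic d t + mu * adjQuadratic d t.
Proof.
have d3 : 3 <= d := n_ge3 R n3.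
exists ((d + 2) * (d + 4) / ((d + 1) * (d + 5))).
exists (3 / ((d + 1) * (d + 5))).
split; first by rewrite !(mulr_gt0, invr_gt0) //; lra.
move=> t.
rewrite horner_jacobi !big_ord_recl big_ord0 /rising !big_ord_recl !big_ord0.
rewrite /= /bump /= !(add1n, addn0) bin0 bin1 binn (_ : 'C(3, 2) = 3%N) // /adjQuadratic /oddCubic.
by field; rewrite !lt0r_neq0 //=; lra.
Qed.

(** Both adjacent polynomials lie in the span of oddCubic and adjQuadratic, where
    the polynomials that vanish at c form a line. *)
Lemma node_polyE (M u a b c : R) : pencil_nodes d M u a b c ->
  M <> d * (d + 1) ->
  exists2 k, k != 0 &
    node_poly n c = k *: (('X - a%:P) * ('X - b%:P) * ('X - c%:P)).
Proof.
move=> H nt; have Dc := adjQuadratic_c_gt0 H nt.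
have d3 : 3 <= d := n_ge3 R n3.
have d3n0 : d + 3 != 0 by apply: lt0r_neq0; lra.
have [lam [mu [lam0 P3]]] := adjacent_jacobi3.
exists (lam * adjQuadratic d c / (d + 3)).
  by rewrite !mulf_neq0 ?invr_eq0 // lt0r_neq0.
apply: poly_ext => t.
rewrite /node_poly hornerD hornerN !hornerZ !hornerM !hornerXsubC.
rewrite (nodesE H) !adjacent_jacobi2 !P3 (oddCubic_c H).
by field.
Qed.

End Jacobi.

(** * Structure of 3-distance 5-designs *)

Theorem theorem2p1 (R : realType) (n : nat) (hn : (3 <= n)%N)
    (C : {fset 'rV[R]_n}) (hC : spherical_code C)
    (h3 : three_distance C) (h5 : spherical_design 5 C)
    (hnt : ~ tight_5_design C)
    (M : nat) (hM : M = #|` C|)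
    (a b c : R) (hab : a < b) (hbc : b < c)
    (habc : inner_products C = [fset a; b; c]) :
  [/\ (`|a| > `|c| /\ `|c| > `|b|) /\ `|b| > 0,
      M%:R = n%:R * ((n%:R + 2) * (n%:R + 3) * c ^+ 2
                     + 4 * (n%:R + 2) * c - n%:R + 1) * (1 - c)
             / (2 * c * (3 - (n%:R + 2) * c ^+ 2)),
      (forall t : R,
         (n%:R + 2) * ((n%:R + 2) * c ^+ 2 + 2 * c - 1) * t ^+ 2
         + 2 * c * (c + 1) * (n%:R + 2) * t
         + 3 - (n%:R + 2) * c ^+ 2 = 0 <-> t = a \/ t = b)
    & exists s alpha0 alpha1 alpha2 : R,
        [/\ max_levenshtein5_root n M s,
            size (node_poly n s) = 4%N,
            (forall t : R, root (node_poly n s) t <->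
               [\/ t = alpha0, t = alpha1 | t = alpha2]),
            [/\ alpha0 < alpha1, alpha1 < alpha2 & alpha2 = s]
          & [/\ a = alpha0, b = alpha1 & c = alpha2]]].
Proof.
have H : pencil_nodes n%:R M%:R (a * b * c) a b c.
  by rewrite hM; apply: design_pencil.
have nt : M%:R <> n%:R * (n%:R + 1) :> R.
  move=> /eqP; rewrite natr1 -natrM eqr_nat hM => /eqP MN.
  by apply: hnt; split=> //; rewrite MN addn1.
have Mc : M%:R = levenshtein5 n c := leven_c H nt.
have [ca bc b0] := distances_abs H nt.
have [k k0 nodeE] := node_polyE hn H nt.
have k1 : (n%:R + 2) * adjQuadratic n%:R c != 0.
  by rewrite mulf_neq0 ?(dim2_neq0 (dim_ge3 H)) // lt0r_neq0 ?(adjQuadratic_c_gt0 H).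
split=> //.
- move=> t; rewrite (quadratic_nodes t H); split=> [|[]->].
  + move/eqP; rewrite mulf_eq0 (negbTE k1) mulf_eq0 !subr_eq0 /=.
    by case/orP=> /eqP ->; [left | right].
  + by rewrite subrr mul0r mulr0.
  + by rewrite subrr !mulr0.
- exists c, a, b, c; split=> //.
  + split=> // t /(leven_roots H) [] -> //; last exact: ltW.
    by rewrite ltW // (lt_trans hab).
  + rewrite nodeE size_scale // !size_Mmonic ?monicXsubC ?mulf_neq0 ?polyXsubC_eq0 //.
    by rewrite !size_XsubC.
  + move=> t; rewrite nodeE rootZ // !rootM !root_XsubC.
    split=> [/orP[/orP[]|] /eqP|]; first exact: Or31.
    * exact: Or32.
    * exact: Or33.
    * by case=> ->; rewrite eqxx ?orbT.
Qed.
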